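(* Let $G$ be a finite, undirected, simple, connected graph. Then the following are equivalent: (i) $G\in\mathbf{l_2}/\mathbf{m_3}$; (ii) $G\in\mathbf{l_3}/\mathbf{m_3}$; (iii) $G\in\mathbf{SP}/\mathbf{m_3}$; (iv) $G$ is HHD-free. That is, $\mathbf{l_2}/\mathbf{m_3}=\mathbf{l_3}/\mathbf{m_3}=\mathbf{SP}/\mathbf{m_3}=\text{HHD-free}$.
   Context: All graphs are finite, undirected, simple and connected. A $uv$-walk is a sequence of (not necessarily distinct) vertices $W: u=v_0,v_1,\ldots,v_n=v$ with $v_{i-1}$ adjacent to $v_i$ for all $i\in\{1,\ldots,n\}$; $v_1,\ldots,v_{n-1}$ are its internal vertices and $n$ is its length. A $uv$-path is a $uv$-walk with distinct vertices. A $uv$-induced path is a $uv$-path in which two vertices are adjacent in $G$ if and only if they are consecutive on the path. For non-adjacent vertices $u,v$: - $\mathbf{m_3}(u,v)$ is the set of $uv$-$m_3$ paths, i.e. $uv$-induced paths of length at least three. - $\mathbf{l_k}(u,v)$ is the set of $uv$-$l_k$-paths, i.e. $uv$-induced paths of length at most $k$. - $\mathbf{SP}(u,v)$ is the set of $uv$-shortest paths, i.e. $uv$-paths of length equal to the distance $d(u,v)$ in $G$. Domination: for non-adjacent $u,v$, a $uv$-walk $W$ dominates a $uv$-walk $W'$ if every internal vertex of $W'$ is adjacent to some internal vertex of $W$ or belongs to $W$. The class $\mathbf{A}/\mathbf{B}$ consists of all graphs $G$ such that for every pair of non-adjacent vertices $u,v$ of $G$, every walk $W\in\mathbf{A}(u,v)$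 dominates every walk $W'\in\mathbf{B}(u,v)$ (vacuously true if one of the sets is empty). A hole is a chordless cycle with at least five vertices. A house is the complement of an induced path with five vertices. A domino is the graph obtained from the chordless cycle $x_0,x_1,\ldots,x_5$ by adding the chord $x_1x_4$. A graph is HHD-free if it contains no house, no hole and no domino as an induced subgraph. *)

(* Defs.v *)
From mathcomp Require Import all_boot.
Set Implicit Arguments.
Unset Strict Implicit.
Unset Printing Implicit Defensive.

(* A finite simple graph is a symmetric irreflexive relation
   on a finType; a walk is the sequence of all its vertices, ends included. *)

Definition connected_graph (T : finType) (e : rel T) : Prop :=
  forall x y : T, connect e x y.

Section Walks.

Variables (T : finType) (e : rel T).
Implicit Types (u v : T) (W : seq T) (k n : nat).

Definition walk u v W : bool :=
  if W is x :: s then [&& x == u, last x s == v & path e x s] else false.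

Definition walk_length W : nat := (size W).-1.

(* W without its first and last entries. *)
Definition internal W : seq T := behead (take (walk_length W) W).

Definition simple_path u v W : bool := walk u v W && uniq W.

(* The vertices of W are distinct, so adjacency may be read on positions. *)
Definition induced_path u v W : Prop :=
  simple_path u v W /\
  forall i j, i < size W -> j < size W ->
    e (nth u W i) (nth u W j) = (j == i.+1) || (i == j.+1).

Definition m3 u v W : Prop := induced_path u v W /\ 3 <= walk_length W.

Definition l_ k u v W : Prop := induced_path u v W /\ walk_length W <= k.

Definition is_distance u v n : Prop :=
  (exists2 W, simple_path u v W & walk_length W = n) /\
  forall W, simple_path u v W -> n <= walk_length W.

Definition SP u v W : Prop :=
  simple_path u v W /\ is_distance u v (walk_length W).

Definition dominates W W' : Prop :=
  forall y, y \in internal W' ->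
    (exists2 x, x \in internal W & e y x) \/ y \in W.

(* e belongs to the class usually written A/B. *)
Definition dominating_class (A B : T -> T -> seq T -> Prop) : Prop :=
  forall u v, u != v -> ~~ e u v ->
    forall W W', A u v W -> B u v W' -> dominates W W'.

End Walks.

Definition contains_induced (S T : finType) (h : rel S) (e : rel T) : Prop :=
  exists2 f : S -> T, injective f & forall x y, e (f x) (f y) = h x y.

(* A cycle in the graph-theoretic sense only for 3 <= n. *)
Definition cycle_graph (n : nat) : rel 'I_n :=
  fun i j => (j == i.+1 %% n :> nat) || (i == j.+1 %% n :> nat).

Definition path_graph (n : nat) : rel 'I_n :=
  fun i j => (j == i.+1 :> nat) || (i == j.+1 :> nat).

Definition complement_graph (T : finType) (e : rel T) : rel T :=
  fun x y => (x != y) && ~~ e x y.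

Definition house : rel 'I_5 := complement_graph (@path_graph 5).

Definition domino : rel 'I_6 :=
  fun i j => [|| cycle_graph i j,
    (i == 1 :> nat) && (j == 4 :> nat) | (i == 4 :> nat) && (j == 1 :> nat)].

Definition HHD_free (T : finType) (e : rel T) : Prop :=
  [/\ ~ contains_induced house e,
      forall n, 5 <= n -> ~ contains_induced (@cycle_graph n) e
    & ~ contains_induced domino e].

(* Main.v *)
(** In a house, a hole or a domino there are vertices [p], [w], [q] and an
    induced path of length at least 3 from [p] to [q] such that [w] is adjacent
    to [p] and [q] but not to every vertex of the path.  Conversely, if [G] is
    HHD-free and such [p], [w], [q] are given, then [w] sees the whole path: a gap
    of length at least 3 between consecutive neighbours of [w] gives a hole, and
    a gap of length 2 together with an adjacent gap gives a house or a domino.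
    This property ([apex_closed]) settles domination by paths of length 2, and it
    also shows that any induced [uv]-path [W] of length at least 3 dominates
    every [m3]-path [W']: non-domination propagates along [W'] from a vertex to
    its successor, up to the neighbour of [v], where it is impossible.  Hence
    A/m3 is the class of HHD-free graphs as soon as A consists of induced paths
    and contains those of length 2. *)

Require Import Defs.
From mathcomp Require Import all_boot.
From mathcomp Require Import zify.
Set Implicit Arguments.
Unset Strict Implicit.
Unset Printing Implicit Defensive.

Section Graph.

Variables (T : finType) (e : rel T).
Hypotheses (e_sym : symmetric e) (e_irr : irreflexive e).

(* [lia] case-splits on every boolean atom, so adjacency facts slow it down. *)
Local Ltac nat_lia :=
  repeat match goal with
  | H : is_true (e _ _) |- _ => clear H
  | H : is_true (~~ e _ _) |- _ => clear H
  end; lia.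

(** * Recognising houses and dominoes from adjacencies *)

(** Injectivity is free: vertices of [h] with the same image have the same neighbours, and no two
    vertices of a house or a domino do. Hence the next two lemmas assume adjacencies only. *)
Lemma contains_induced_twin_free (S : finType) (h : rel S) (f : S -> T) :
    (forall x y, (forall z, h x z = h y z) -> x = y) ->
    (forall x y, e (f x) (f y) = h x y) ->
  contains_induced h e.
Proof.
move=> twin_free fE; exists f => // x y fxy.
by apply: twin_free => z; rewrite -!fE fxy.
Qed.

Lemma house_contained a b c d r :
    [&& e a b, e b c, e c d, e d a, e r a & e r b] ->
    [&& ~~ e a c, ~~ e b d, ~~ e r c & ~~ e r d] ->
  contains_induced house e.
Proof.
case/and5P=> ab bc cd da /andP[ra rb] /and4P[/negPf ac /negPf bd /negPf rc /negPf rd].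
(* The non-edges form the path [a, c, r, d, b], whose complement is the house. *)
apply: (@contains_induced_twin_free _ _ (fun i : 'I_5 => nth a [:: a; c; r; d; b] i)).
  move=> x y xy; have xyv k (kl : k < 5) := xy (Ordinal kl).
  move: (xyv 0 isT) (xyv 1 isT) (xyv 2 isT) (xyv 3 isT) (xyv 4 isT).
  rewrite /house /complement_graph /path_graph -!val_eqE /= => {xy xyv}.
  case: x y => [i ilt] [j jlt] /=.
  by move: i j ilt jlt => [|[|[|[|[|//]]]]] [|[|[|[|[|//]]]]] ilt jlt *;
    apply/val_inj.
move=> [i ilt] [j jlt]; rewrite /house /complement_graph /path_graph -!val_eqE /=.
by move: i j ilt jlt => [|[|[|[|[|//]]]]] [|[|[|[|[|//]]]]] _ _ /=;
  rewrite ?e_irr ?(ab, bc, cd, da, ra, rb, ac, bd, rc, rd) //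
    e_sym ?(ab, bc, cd, da, ra, rb, ac, bd, rc, rd).
Qed.

Lemma domino_contained a b c d x y :
    [&& e a b, e b c, e c d, e d x, e x y, e y a & e b x] ->
    [&& ~~ e a c, ~~ e a d, ~~ e a x, ~~ e b d, ~~ e b y, ~~ e c x, ~~ e c y
      & ~~ e d y] ->
  contains_induced domino e.
Proof.
case/and5P=> ab bc cd dx /and3P[xy ya bx].
case/and5P=> /negPf ac /negPf ad /negPf ax /negPf bd.
case/and4P=> /negPf by_ /negPf cx /negPf cy /negPf dy.
apply: (@contains_induced_twin_free _ _ (fun i : 'I_6 => nth a [:: a; b; c; d; x; y] i)).
  move=> i j ij; have ijv k (kl : k < 6) := ij (Ordinal kl).
  move: (ijv 0 isT) (ijv 1 isT) (ijv 2 isT) (ijv 3 isT) (ijv 4 isT) (ijv 5 isT).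
  rewrite /domino /cycle_graph /= => {ij ijv}.
  case: i j => [i ilt] [j jlt] /=.
  by move: i j ilt jlt => [|[|[|[|[|[|//]]]]]] [|[|[|[|[|[|//]]]]]] ilt jlt *;
    apply/val_inj.
move=> [i ilt] [j jlt]; rewrite /domino /cycle_graph /=.
by move: i j ilt jlt => [|[|[|[|[|[|//]]]]]] [|[|[|[|[|[|//]]]]]] _ _ /=;
  rewrite ?e_irr ?(ab, bc, cd, dx, xy, ya, bx, ac, ad, ax, bd, by_, cx, cy, dy) //
    e_sym ?(ab, bc, cd, dx, xy, ya, bx, ac, ad, ax, bd, by_, cx, cy, dy).
Qed.

Lemma cycle_graphE n (i j : 'I_n.+1) :
  cycle_graph i j = [|| j == i.+1 :> nat, i == j.+1 :> nat,
    (i == n :> nat) && (j == 0 :> nat) | (j == n :> nat) && (i == 0 :> nat)].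
Proof.
have succ_mod (k : 'I_n.+1) : k.+1 %% n.+1 = if k == n :> nat then 0 else k.+1.
  have := ltn_ord k; rewrite ltnS; case: eqP => [->|kn kle]; first by rewrite modnn.
  by rewrite modn_small //; lia.
rewrite /cycle_graph !succ_mod; have := ltn_ord i; have := ltn_ord j.
by case: (nat_of_ord i =P n); case: (nat_of_ord j =P n); lia.
Qed.

(** * Induced paths as functions on positions, and holes *)

(* [z 0, ..., z n] is an induced path; positions above [n] are irrelevant. *)
Definition chordless (z : nat -> T) n :=
  forall i j, i <= n -> j <= n ->
    e (z i) (z j) = (j == i.+1) || (i == j.+1) /\ (z i = z j -> i = j).

Lemma chordless_adj z n i j : chordless z n -> i <= n -> j <= n ->
  e (z i) (z j) = (j == i.+1) || (i == j.+1).
Proof. by move=> zP ile jle; have [] := zP i j ile jle. Qed.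

Lemma chordless_inj z n i j : chordless z n -> i <= n -> j <= n ->
  z i = z j -> i = j.
Proof. by move=> zP ile jle; have [] := zP i j ile jle. Qed.

(** A vertex of an induced path sees both ends only if the path has length 2. *)
Lemma apex_notin z n w k : 3 <= n -> chordless z n -> e w (z 0) -> e w (z n) ->
  k <= n -> w != z k.
Proof.
move=> n3 zP w0 wn kle; apply/eqP=> wk; move: w0 wn.
by rewrite wk !(chordless_adj zP) //; lia.
Qed.

Lemma hole_contained z n w : 3 <= n -> chordless z n ->
    (forall k, k <= n -> e w (z k) = (k == 0) || (k == n)) ->
  contains_induced (@cycle_graph n.+2) e.
Proof.
move=> n3 zP wP.
have wz k : k <= n -> w != z k.
  by apply: apex_notin; rewrite ?wP ?eqxx ?orbT.
(* The apex takes the last index and closes the cycle between [z n] and [z 0]. *)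
exists (fun i : 'I_n.+2 => if i == n.+1 :> nat then w else z i).
  move=> i j; have := ltn_ord i; have := ltn_ord j; rewrite !ltnS.
  case: eqP => [ni|ni]; case: eqP => [nj|nj] jle ile.
  - by move=> _; apply/val_inj; rewrite /= ni nj.
  - by move/eqP; rewrite (negPf (wz _ _)) //; lia.
  - by move/esym/eqP; rewrite (negPf (wz _ _)) //; lia.
  - by move=> zij; apply/val_inj/(chordless_inj zP) => //=; lia.
move=> i j; rewrite cycle_graphE; have := ltn_ord i; have := ltn_ord j.
rewrite !ltnS; case: eqP => [->|ni]; case: eqP => [->|nj] jle ile.
- by rewrite e_irr; lia.
- by rewrite wP; lia.
- by rewrite e_sym wP; lia.
- by rewrite (chordless_adj zP); lia.
Qed.

Lemma chordless_shift z n b c : b <= c <= n -> chordless z n ->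
  chordless (fun k => z (b + k)) (c - b).
Proof.
move=> bc zP i j ile jle.
by split; [rewrite (chordless_adj zP); lia | move/(chordless_inj zP); lia].
Qed.

Lemma chordless_le z n m : m <= n -> chordless z n -> chordless z m.
Proof. by move=> mn zP i j ile jle; apply: zP; lia. Qed.

Lemma chordless_rev z n : chordless z n -> chordless (fun k => z (n - k)) n.
Proof.
move=> zP i j ile jle.
by split; [rewrite (chordless_adj zP); lia | move/(chordless_inj zP); lia].
Qed.

Lemma chordless_cat a m b l : chordless a m -> chordless b l ->
    (forall i j, i <= m -> j <= l ->
      e (a i) (b j) = (i == m) && (j == 0) /\ a i != b j) ->
  chordless (fun k => if k <= m then a k else b (k - m.+1)) (m + l).+1.
Proof.
move=> aP bP abP i j ile jle.
case: leqP => im; case: leqP => jm.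
- by split; [rewrite (chordless_adj aP); lia | move/(chordless_inj aP); lia].
- have jl : j - m.+1 <= l by lia.
  have [-> ne] := abP _ _ im jl.
  by split; [lia | move/eqP; rewrite (negPf ne)].
- have il : i - m.+1 <= l by lia.
  have [abE ne] := abP _ _ jm il.
  by rewrite e_sym abE; split; [lia | move/esym/eqP; rewrite (negPf ne)].
- by split; [rewrite (chordless_adj bP); lia | move/(chordless_inj bP); lia].
Qed.

Definition apex_closed := forall z n w, 3 <= n -> chordless z n ->
  e w (z 0) -> e w (z n) -> forall k, k <= n -> e w (z k).

(** * Apex closure in HHD-free graphs *)

Section HHDfree.

Hypothesis hhd : HHD_free e.

(** If the first neighbour [z c] of [w] after [z i] had [c >= i + 3], then [w] and [z i, ..., z c]
    would form a hole. *)
Lemma next_neighbour z n w i : 3 <= n -> chordless z n -> i < n -> e w (z n) ->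
    e w (z i) ->
  e w (z i.+1) || (i.+2 <= n) && e w (z i.+2).
Proof.
move=> n3 zP ilt wn wi.
have ex : exists c, (i < c <= n) && e w (z c) by exists n; rewrite ilt leqnn.
case: (ex_minnP ex) => c /andP[/andP[ic cn] wc] cmin.
have [c3|c3] := leqP (i + 3) c; last first.
  have [cE|cE] : c = i.+1 \/ c = i.+2 by lia.
    by rewrite -cE wc.
  by rewrite -cE wc cn orbT.
case: hhd => _ /(_ (c - i).+2) []; first by lia.
apply: (hole_contained (z := fun k => z (i + k)) (w := w)); first by lia.
  by apply: chordless_shift zP; lia.
move=> k kle; have [-> | k0] := eqVneq k 0; first by rewrite addn0 wi.
have [-> | kc] /= := eqVneq k (c - i); first by rewrite subnKC // ltnW.
by apply/negP=> wk; have := cmin (i + k); rewrite wk; lia.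
Qed.

Lemma prev_neighbour z n w i : 3 <= n -> chordless z n -> 0 < i <= n ->
    e w (z 0) -> e w (z i) ->
  e w (z i.-1) || (1 < i) && e w (z i.-2).
Proof.
move=> n3 zP ile w0 wi.
have lt_n : n - i < n by lia.
have := next_neighbour (w := w) n3 (chordless_rev zP) lt_n.
rewrite subnn subKn; last by lia.
move=> /(_ w0 wi).
have -> : n - (n - i).+1 = i.-1 by lia.
have -> : n - (n - i).+2 = i.-2 by lia.
by have -> : ((n - i).+2 <= n) = (1 < i) by lia.
Qed.

Lemma apex_adjacent : apex_closed.
Proof.
move=> z n w n3 zP w0 wn; have [nhouse _ ndomino] := hhd.
have zE := chordless_adj zP.
suff step i : i < n -> e w (z i) -> e w (z i.+1).
  by elim=> [|k IHk] kle //; apply: step; rewrite ?IHk // ltnW.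
move=> ilt wi; apply/negPn/negP=> nwi1.
have := next_neighbour n3 zP ilt wn wi.
rewrite (negPf nwi1) /= => /andP[i2n wi2].
(* Now [w, z i, z i.+1, z i.+2] is an induced square. The gap to its right completes it to a house
   if it has length 1, to a domino if it has length 2. *)
have [i2|i2] := ltnP i.+2 n.
  have [wi3|nwi3] := boolP (e w (z i.+3)).
    apply: nhouse; apply: (@house_contained w (z i.+2) (z i.+1) (z i) (z i.+3)).
      by rewrite wi2 (e_sym _ w) wi (e_sym _ w) wi3 !zE; clear -i2; lia.
    by rewrite nwi1 !zE; clear -i2; lia.
  have := next_neighbour n3 zP i2 wn wi2.
  rewrite (negPf nwi3) /= => /andP[i4n wi4]; apply: ndomino.
  apply: (@domino_contained (z i.+1) (z i.+2) (z i.+3) (z i.+4) w (z i)).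
    by rewrite !(e_sym _ w) wi wi2 wi4 !zE; clear -i4n; lia.
  by rewrite !(e_sym _ w) nwi1 nwi3 !zE; clear -i4n; lia.
(* Here [i.+2 = n], so [3 <= n] leaves a gap to the left of the square; the argument is mirrored. *)
have i0 : 0 < i <= n by lia.
have [wi3|nwi3] := boolP (e w (z i.-1)).
  apply: nhouse; apply: (@house_contained w (z i) (z i.+1) (z i.+2) (z i.-1)).
    by rewrite wi (e_sym _ w) wi2 (e_sym _ w) wi3 !zE; clear -i2n i0; lia.
  by rewrite nwi1 !zE; clear -i2n i0; lia.
have := prev_neighbour n3 zP i0 w0 wi.
rewrite (negPf nwi3) /= => /andP[i1 wi4]; apply: ndomino.
apply: (@domino_contained (z i.+1) (z i) (z i.-1) (z i.-2) w (z i.+2)).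
  by rewrite !(e_sym _ w) wi wi2 wi4 !zE; clear -i2n i0 i1; lia.
by rewrite !(e_sym _ w) nwi1 nwi3 !zE; clear -i2n i0 i1; lia.
Qed.

(* Going back along [w] from [w p.-1] until [x] is met or neighboured, and then
   forward along [x], gives an induced path to [x c] whose ends see [w p]. *)
Lemma splice x c w p : chordless x c -> chordless w p -> 0 < p -> x 0 = w 0 ->
    e (w p) (x c) ->
    (forall r, r < p -> w r != x c /\ ~~ e (w r) (x c)) ->
  e (w p) (x c.-1) || e (w p.-1) (x c.-1).
Proof.
move=> xP wP p0 xw0 wpc far; apply/negPn/negP; rewrite negb_or => /andP[npx np1x].
have c0 : 0 < c by case: c {xP wpc npx np1x} far => // /(_ 0 p0); rewrite xw0 eqxx; case.
have xE := chordless_adj xP.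
(* Let [r] be the last touching index below [p]: no vertex of [w] strictly between [w r] and [w p]
   lies on or sees [x 0, ..., x c]. *)
pose touch r := [exists s : 'I_c, (w r == x s) || e (w r) (x s)].
have ex : exists r, (r < p) && touch r.
  by exists 0; rewrite p0; apply/existsP; exists (Ordinal c0); rewrite /= xw0 eqxx.
have bd r : (r < p) && touch r -> r <= p by case/andP=> /ltnW.
case: (ex_maxnP ex bd) => r /andP[rp /existsP[[s slt] /= wxs]] rmax.
have wfar q t : r < q < p -> t <= c -> w q != x t /\ ~~ e (w q) (x t).
  move=> rq; rewrite leq_eqVlt => /orP[/eqP->|tc]; first by apply: far; lia.
  suff : ~~ ((w q == x t) || e (w q) (x t)) by rewrite negb_or => /andP[].
  apply/negP=> wq; suff : q <= r by lia.
  apply: rmax; apply/andP; split; first by lia.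
  by apply/existsP; exists (Ordinal tc).
(* If [w r] is some [x t], then [r = p.-1] and [w p] sees both [x t] and [x c]. The negated
   conclusions exclude [t = c.-1] and [t = c.-2], so [apex_adjacent] applies to this segment of
   [x]. *)
have [weq|wneq] := boolP [exists s : 'I_c, w r == x s].
  case/existsP: weq => -[t tlt] /= /eqP wt.
  have rE : r = p.-1.
    apply/eqP/negPn/negP=> rne.
    have r1p : r < r.+1 < p by lia.
    have [_] := wfar r.+1 t r1p (ltnW tlt).
    by rewrite -wt (chordless_adj wP); lia.
  have tc1 : t != c.-1.
    apply: contraNneq npx => tE; rewrite -tE -wt rE (chordless_adj wP); lia.
  have t3 : 3 <= c - t.
    by move: np1x; rewrite -rE wt xE; lia.
  have tP : chordless (fun k => x (t + k)) (c - t).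
    by apply: chordless_shift xP; lia.
  have := apex_adjacent t3 tP (w := w p).
  rewrite addn0 subnKC ?(ltnW tlt) // -wt (chordless_adj wP); try lia.
  have -> : (r == p.+1) || (p == r.+1) by lia.
  move=> /(_ isT wpc (c - t).-1); have -> : t + (c - t).-1 = c.-1 by lia.
  by rewrite (negPf npx) => /(_ (leq_pred _)).
have wne q : q < c -> w r != x q.
  by move=> qc; apply: contra wneq => wq; apply/existsP; exists (Ordinal qc).
have exs : exists s, (s < c) && e (w r) (x s).
  by exists s; rewrite slt; move: wxs; rewrite (negPf (wne _ slt)).
have bds t : (t < c) && e (w r) (x t) -> t <= c by case/andP=> /ltnW.
case: (ex_maxnP exs bds) => t /andP[tc wrt] tmax {s slt wxs exs bds}.
(* [a] goes back from [w p.-1] to [w r], and [b] goes on from [x t], the last neighbour of [w r]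
   before [x c]. Their concatenation is induced, and [w p] sees both of its ends. *)
pose a k := w (r + (p.-1 - r - k)); pose b k := x (t + k).
have aP : chordless a (p.-1 - r).
  by apply: (chordless_rev (z := fun k => w (r + k))); apply: chordless_shift wP; lia.
have bP : chordless b (c - t) by apply: chordless_shift xP; lia.
have abP i j : i <= p.-1 - r -> j <= c - t ->
    e (a i) (b j) = (i == p.-1 - r) && (j == 0) /\ a i != b j.
  move=> im jl; rewrite /a /b; have [-> /=|im'] := eqVneq i (p.-1 - r).
    rewrite subnn addn0; have [->|j0] := eqVneq j 0.
      by rewrite addn0 wrt wne.
    have [->|jc] := eqVneq (t + j) c.
      by have [-> /negPf->] := far r rp.
    have tjc : t + j < c by lia.
    split; last exact: wne.
    apply/negP=> wtj; have := tmax (t + j); rewrite tjc wtj => /(_ isT).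
    by lia.
  have qr : r < r + (p.-1 - r - i) < p by lia.
  have tjc : t + j <= c by lia.
  by have [-> /negPf->] := wfar _ _ qr tjc.
(* Length 2 would mean [r = p.-1] and [t = c.-1], against [np1x]. *)
have n3 : 3 <= (p.-1 - r + (c - t)).+1.
  have [rE|] := eqVneq r p.-1; have [tE|] := eqVneq t c.-1; try lia.
  by move: np1x; rewrite -rE -tE wrt.
have := apex_adjacent n3 (chordless_cat aP bP abP) (w := w p).
have -> /= : (p.-1 - r + (c - t)).+1 <= p.-1 - r = false by lia.
rewrite /a /b subn0 subnKC; last by lia.
have -> : t + ((p.-1 - r + (c - t)).+1 - (p.-1 - r).+1) = c by lia.
rewrite (chordless_adj wP); try lia.
have -> : (p.-1 == p.+1) || (p == p.-1.+1) by lia.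
(* The last vertex but one of the concatenation is [x c.-1], which [w p] does not see. *)
move=> /(_ isT wpc (p.-1 - r + (c - t))).
rewrite leqnSn => /(_ isT); case: leqP => [|_]; first by lia.
have -> : t + (p.-1 - r + (c - t) - (p.-1 - r).+1) = c.-1 by lia.
by rewrite (negPf npx).
Qed.

(** * Two induced paths with common ends *)

Section TwoPaths.

Variables (x w : nat -> T) (n d : nat).
Hypotheses (xP : chordless x n) (wP : chordless w d).
Hypotheses (xw0 : x 0 = w 0) (xwn : x n = w d) (n3 : 3 <= n).

Definition undominated i := forall q, 0 < q < d -> w q != x i /\ ~~ e (w q) (x i).

Let xE i j := @chordless_adj x n i j xP.
Let wE i j := @chordless_adj w d i j wP.

(** The common end [x n] is seen by [w d.-1] and by no earlier vertex of [w]. Splicing there makes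
    [w d.-1] or [w d.-2] see [x n.-1], and both are internal because [3 <= d]. *)
Lemma last_dominated : 3 <= d -> ~ undominated n.-1.
Proof.
move=> d3 und.
have dP : chordless w d.-1 by apply: chordless_le wP; nat_lia.
have far r : r < d.-1 -> w r != x n /\ ~~ e (w r) (x n).
  move=> rd; rewrite xwn wE; try nat_lia.
  by split; [apply/eqP => /(chordless_inj wP) | ]; nat_lia.
have := splice xP dP _ xw0 _ far; case/(_ _ _)/orP; try nat_lia.
- by rewrite xwn wE; nat_lia.
- by apply/negP; case: (und d.-1); nat_lia.
- by apply/negP; case: (und d.-2); nat_lia.
Qed.

(* Otherwise [x 0, x 1, x 2, w 1] is a chordless 4-cycle, and splicing [x] and
   [w] from their common end [x n] yields a house or a domino on top of it. *)
Lemma start_not_square : 3 <= d -> undominated 1 -> ~~ e (w 1) (x 2).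
Proof.
move=> d3 und; have [nhouse _ ndomino] := hhd; apply/negP=> w1x2.
have [d2 d1 n2 n1] : [/\ 2 <= d, 1 <= d, 2 <= n & 1 <= n] by split; nat_lia.
have [_ w1x1] := und 1 d2.
have [_ w2x1] := und 2 d3.
have x0w1 : e (x 0) (w 1) by rewrite xw0 wE.
have x0w2 : ~~ e (x 0) (w 2) by rewrite xw0 wE.
have w12 : e (w 1) (w 2) by rewrite wE.
have x01 : e (x 0) (x 1) by rewrite xE.
have x12 : e (x 1) (x 2) by rewrite xE.
have x23 : e (x 2) (x 3) by rewrite xE.
have x02 : ~~ e (x 0) (x 2) by rewrite xE.
have x03 : ~~ e (x 0) (x 3) by rewrite xE.
have x13 : ~~ e (x 1) (x 3) by rewrite xE.
have w2x2 : ~~ e (w 2) (x 2).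
  apply/negP=> w2x2; apply: nhouse.
  apply: (@house_contained (w 1) (x 2) (x 1) (x 0) (w 2)).
    by rewrite w1x2 e_sym x12 e_sym x01 x0w1 e_sym w12.
  by rewrite w1x1 e_sym x02 w2x1 e_sym x0w2.
have w1x3 : ~~ e (w 1) (x 3).
  apply/negP=> w1x3; apply: nhouse.
  apply: (@house_contained (w 1) (x 2) (x 1) (x 0) (x 3)).
    by rewrite w1x2 e_sym x12 e_sym x01 x0w1 e_sym w1x3 e_sym x23.
  by rewrite w1x1 e_sym x02 e_sym x13 e_sym x03.
(* Such a [c] would form a second square [x 2, c, w 2, w 1], glued to the first along the edge from
   [x 2] to [w 1]. *)
have no_domino c : e c (x 2) -> e c (w 2) -> ~~ e c (x 0) -> ~~ e c (x 1) ->
    ~~ e c (w 1) -> False.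
  move=> c2 cw2 c0 c1 cw1; apply: ndomino.
  apply: (@domino_contained (x 1) (x 2) c (w 2) (w 1) (x 0)).
    by rewrite x12 e_sym c2 cw2 e_sym w12 e_sym x0w1 x01 e_sym w1x2.
  by rewrite e_sym c1 e_sym w2x1 e_sym w1x1 e_sym w2x2 e_sym x02 cw1 c0 e_sym x0w2.
have w3x2 : ~~ e (w 3) (x 2).
  apply/negP=> w3x2; apply: (no_domino (w 3)) => //.
  - by rewrite wE; nat_lia.
  - by rewrite xw0 wE; nat_lia.
  - have [d4|d3'] := ltnP 3 d; first by case: (und 3 d4).
    by rewrite (_ : 3 = d) -?xwn ?xE; nat_lia.
  - by rewrite wE; nat_lia.
(* For [r >= 4], if [x 2] saw [w r] it would be an apex over [w 1, ..., w r] and would see [w 2]. *)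
have wx2 r : 2 <= r <= d -> ~~ e (w r) (x 2).
  move=> rd; have [->//|r2] := eqVneq r 2; have [->//|r3] := eqVneq r 3.
  have rP : chordless (fun k => w (1 + k)) (r - 1).
    by apply: chordless_shift wP; nat_lia.
  have r4 : 3 <= r - 1 by nat_lia.
  rewrite e_sym in w1x2; rewrite e_sym in w2x2.
  rewrite e_sym; apply: contra w2x2 => x2wr.
  apply: (apex_adjacent r4 rP (w := x 2)) => //; rewrite ?subnKC //; nat_lia.
(* Both paths are reversed, ending at [x 2] and [w 1]. Splicing makes [w 1] or [w 2] see [x 3]; the
   first is excluded, so [x 3] completes the domino. *)
have x'P : chordless (fun k => x (n - k)) (n - 2).
  by apply: chordless_le (chordless_rev xP); nat_lia.
have w'P : chordless (fun k => w (d - k)) (d - 1).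
  by apply: chordless_le (chordless_rev wP); nat_lia.
have := splice x'P w'P; rewrite !subn0 !subKn; try nat_lia.
have -> : n - (n - 2).-1 = 3 by nat_lia.
have -> : d - (d - 1).-1 = 2 by nat_lia.
rewrite (negPf w1x3) /= => /(_ _ xwn w1x2) splice'.
apply: (no_domino (x 3)); rewrite // 1?e_sym //.
apply: splice' => [|r rd]; first by nat_lia.
have dr : 2 <= d - r <= d by nat_lia.
split; last exact: wx2.
have [->|r0] := eqVneq r 0.
  by rewrite subn0 -xwn; apply/eqP=> /(chordless_inj xP); nat_lia.
have rd' : 0 < d - r < d by nat_lia.
by apply/eqP=> wxr; case: (und _ rd') => _; rewrite wxr xE; nat_lia.
Qed.

(** Splice at the first internal vertex [w p] that sees [x i.+1]: then [w p] or [w p.-1] sees [x i].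
    This contradicts the hypothesis on [x i] unless [p = 1]. *)
Lemma undominated_next i : 3 <= d -> 0 < i -> i.+1 < n -> undominated i ->
  undominated i.+1.
Proof.
move=> d3 i0 i1n und q qd.
have ne r : 0 < r < d -> w r != x i.+1.
  move=> rd; apply: contraTneq isT => wr; have [_] := und r rd.
  by rewrite wr xE; nat_lia.
split; first exact: ne.
apply/negP=> wq.
have ex : exists p, (0 < p < d) && e (w p) (x i.+1) by exists q; rewrite qd.
case: (ex_minnP ex) => p /andP[pd wp] pmin.
have iP : chordless x i.+1 by apply: chordless_le xP; nat_lia.
have pP : chordless w p by apply: chordless_le wP; nat_lia.
have far r : r < p -> w r != x i.+1 /\ ~~ e (w r) (x i.+1).
  move=> rp; have [->|r0] := eqVneq r 0.
    rewrite -xw0 xE; try nat_lia.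
    by split; [apply/eqP => /(chordless_inj xP) | ]; nat_lia.
  have rd : 0 < r < d by nat_lia.
  split; first exact: ne.
  by apply/negP=> wr; have := pmin r; rewrite rd wr; lia.
have p0 : 0 < p by case/andP: pd.
case/orP: (splice iP pP p0 xw0 wp far) => /=.
  by apply/negP; case: (und p pd).
(* For [p = 1] the vertex [w p.-1] is [x 0], which is not internal. It sees [x i] only for [i = 1],
   and this is the square excluded by [start_not_square]. *)
have [p1|p1] := eqVneq p 1; last by apply/negP; case: (und p.-1); nat_lia.
rewrite p1 -xw0 xE; try nat_lia.
move=> i1; have {i1} i1 : i = 1 by nat_lia.
by move: und wp; rewrite i1 p1 => /(start_not_square d3)/negP.
Qed.

Lemma all_dominated i : 2 <= d -> 0 < i < n ->
  exists2 q, 0 < q < d & (w q == x i) || e (w q) (x i).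
Proof.
move=> d2 i_n; have [d_2|d3] := leqP d 2.
  have dE : d = 2 by nat_lia.
  exists 1; first by nat_lia.
  have -> : e (w 1) (x i); last by rewrite orbT.
  by apply: (apex_adjacent n3 xP); rewrite ?xw0 ?xwn ?wE; nat_lia.
have [/existsP[q /andP[q0 wq]]|/existsPn none] :=
  boolP [exists q : 'I_d, (0 < q) && ((w q == x i) || e (w q) (x i))].
  by exists q; rewrite ?q0 ?ltn_ord.
have und : undominated i.
  move=> q /andP[q0 qd]; have := none (Ordinal qd).
  by rewrite /= q0 /= negb_or => /andP.
suff: undominated n.-1 by move/(last_dominated d3).
have und_from k : i + k < n -> undominated (i + k).
  elim: k => [|k IHk] ik; first by rewrite addn0.
  rewrite addnS; apply: undominated_next => //; try nat_lia.
  by apply: IHk; nat_lia.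
by have -> : n.-1 = i + (n.-1 - i); [nat_lia | apply: und_from; nat_lia].
Qed.

End TwoPaths.

End HHDfree.

(** * From sequences to functions; domination and shortest paths *)

Lemma walkE u v W :
  walk e u v W =
    [&& 0 < size W, nth u W 0 == u, nth u W (size W).-1 == v & sorted e W].
Proof. by case: W => //= x s; rewrite (last_nth u). Qed.

Lemma internalP (u : T) W y :
  reflect (exists2 i, 0 < i < (size W).-1 & nth u W i = y) (y \in internal W).
Proof.
rewrite /internal /walk_length; set m := (size W).-1.
have sz : size (take m W) = m by rewrite size_takel // leq_pred.
apply: (iffP (nthP u)); rewrite size_behead sz.
  case=> i im; rewrite nth_behead nth_take; last by lia.
  by exists i.+1; first by lia.
by case=> -[|i] // im iy; exists i; [lia | rewrite nth_behead nth_take].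
Qed.

Lemma chordless_nth u v W : induced_path e u v W ->
  [/\ chordless (nth u W) (size W).-1, nth u W 0 = u & nth u W (size W).-1 = v].
Proof.
case=> /andP[]; rewrite walkE => /and4P[W0 /eqP Wu /eqP Wv _] W_uniq WE.
split=> // i j ile jle; have [iW jW] : i < size W /\ j < size W by lia.
by split; [apply: WE | move/eqP; rewrite nth_uniq // => /eqP].
Qed.

Lemma induced_path_mkseq z n : chordless z n ->
  induced_path e (z 0) (z n) (mkseq z n.+1).
Proof.
move=> zP; split; last first.
  move=> i j; rewrite size_mkseq => ilt jlt.
  by rewrite !nth_mkseq // (chordless_adj zP).
apply/andP; split.
  rewrite walkE size_mkseq !nth_mkseq // !eqxx ltn0Sn !andTb.
  apply/(sortedP (z 0)) => i; rewrite size_mkseq => ilt.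
  by rewrite !nth_mkseq ?(chordless_adj zP); lia.
rewrite map_inj_in_uniq ?iota_uniq // => i j; rewrite !mem_iota => ilt jlt.
by apply: chordless_inj zP _ _; lia.
Qed.

Lemma HHD_free_dominates u v W W' : HHD_free e -> u != v -> ~~ e u v ->
  induced_path e u v W -> m3 e u v W' -> dominates e W W'.
Proof.
move=> hhd uv nuv /chordless_nth[wP w0 wd] [/chordless_nth[xP x0 xn] n3] y.
move/(internalP u)=> [i i_n <-].
have d2 : 2 <= (size W).-1.
  case: (size W).-1 wd w0 wP => [|[|d]] // wd w0 wP.
    by move: uv; rewrite -w0 -wd eqxx.
  by move: nuv; rewrite -w0 -wd (chordless_adj wP).
have xw0 : nth u W' 0 = nth u W 0 by rewrite x0 w0.
have xwn : nth u W' (size W').-1 = nth u W (size W).-1 by rewrite xn wd.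
have [q qd /orP[/eqP wx|wx]] := all_dominated hhd xP wP xw0 xwn n3 d2 i_n.
  right; rewrite -wx mem_nth //; case/andP: qd => _ /leq_trans -> //.
  exact: leq_pred.
left; exists (nth u W q); last by rewrite e_sym.
by apply/(internalP u); exists q.
Qed.

(** The only internal vertex of [[:: z 0; w; z n]] is [w], and [z k] is not on this walk when
    [0 < k < n]. So domination of the path [z] says exactly that [w] sees [z k]. *)
Lemma dominating_apex_closed (A : T -> T -> seq T -> Prop) :
    (forall u w v, u != v -> ~~ e u v -> e u w -> e w v -> A u v [:: u; w; v]) ->
  dominating_class e A (m3 e) -> apex_closed.
Proof.
move=> A2 dom z n w n3 zP w0 wn k kle.
have [->//|k0] := eqVneq k 0; have [->//|kn] := eqVneq k n.
have zuv : z 0 != z n by apply/eqP=> /(chordless_inj zP); lia.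
have nzuv : ~~ e (z 0) (z n) by rewrite (chordless_adj zP); lia.
have zk : z k \in internal (mkseq z n.+1).
  apply/(internalP (z 0)); exists k; rewrite ?size_mkseq; first by lia.
  by rewrite nth_mkseq.
have z_m3 : m3 e (z 0) (z n) (mkseq z n.+1).
  by split; [apply: induced_path_mkseq | rewrite /walk_length size_mkseq].
have zw : A (z 0) (z n) [:: z 0; w; z n] by apply: A2; rewrite // e_sym.
case: (dom _ _ zuv nzuv _ _ zw z_m3 _ zk) => [[x]|].
  by rewrite inE => /eqP->; rewrite e_sym.
have := apex_notin n3 zP w0 wn kle; rewrite !inE eq_sym => /negPf->.
by case/or3P=> // /eqP /(chordless_inj zP); lia.
Qed.

Lemma short_path_induced u w v : u != v -> ~~ e u v -> e u w -> e w v ->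
  induced_path e u v [:: u; w; v].
Proof.
move=> uv /negPf nuv uw wv; split.
  rewrite /simple_path /= !eqxx uw wv !inE negb_or uv !andbT /=.
  by apply/andP; split; apply/eqP=> wE; move: uw wv; rewrite wE e_irr.
by move=> [|[|[|//]]] [|[|[|//]]] _ _ /=;
  rewrite ?e_irr ?(uw, wv, nuv) // e_sym ?(uw, wv, nuv).
Qed.

Lemma short_path_SP u w v : u != v -> ~~ e u v -> e u w -> e w v ->
  SP e u v [:: u; w; v].
Proof.
move=> uv nuv uw wv; have [sp _] := short_path_induced uv nuv uw wv.
split=> //; split; first by exists [:: u; w; v].
case=> [|x [|y [|//]]] // /andP[]; rewrite /= ?andbT.
  by case/andP=> /eqP->; rewrite (negPf uv).
by case/and3P=> /eqP-> /eqP->; rewrite (negPf nuv).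
Qed.

Lemma SP_induced u v W : SP e u v W -> induced_path e u v W.
Proof.
case=> sp [_ Wmin]; split=> //; case/andP: sp.
rewrite walkE => /and4P[W0 /eqP Wu /eqP Wv /(sortedP u) W_sorted] W_uniq.
have no_chord i j : i.+1 < j < size W -> ~~ e (nth u W i) (nth u W j).
  move=> ij; apply/negP=> chord.
  (* A chord from position [i] to position [j] gives the shortcut [W1], a strictly shorter path. *)
  pose W1 := take i.+1 W ++ drop j W.
  have sz1 : size (take i.+1 W) = i.+1 by rewrite size_takel; lia.
  have sz : size W1 = i.+1 + (size W - j) by rewrite size_cat sz1 size_drop.
  have nthW1 k : nth u W1 k = nth u W (if k <= i then k else j + (k - i.+1)).
    by rewrite nth_cat sz1 ltnS nth_drop; case: leqP => // ki; rewrite nth_take.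
  suff /Wmin : simple_path e u v W1 by rewrite /walk_length sz; lia.
  apply/andP; split; last first.
    apply: subseq_uniq W_uniq; rewrite -[X in subseq _ X](cat_take_drop i.+1 W).
    apply: cat_subseq => //.
    have -> : j = j - i.+1 + i.+1 by lia.
    by rewrite -drop_drop drop_subseq.
  rewrite walkE sz !nthW1 Wu eqxx /=.
  rewrite (_ : (if _ then _ else _) = (size W).-1) ?Wv ?eqxx /=; last first.
    by case: leqP; lia.
  apply/(sortedP u) => k; rewrite sz !nthW1 => klt.
  have [ki|ik|->] := ltngtP k i; last by rewrite subnn addn0.
    by apply: W_sorted; lia.
  rewrite subSS (_ : j + (k - i) = (j + (k - i.+1)).+1).
    by apply: W_sorted; lia.
  by lia.
move=> i j iW jW; have [ij|ji|->] := ltngtP i j; last by rewrite e_irr; lia.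
  have [->|ne] := eqVneq j i.+1; first by rewrite W_sorted //; lia.
  by rewrite (negPf (no_chord _ _ _)); lia.
rewrite e_sym; have [->|ne] := eqVneq i j.+1; first by rewrite W_sorted ?orbT //; lia.
by rewrite (negPf (no_chord _ _ _)); lia.
Qed.

End Graph.

(** * Apex closure fails in the forbidden graphs *)

(** Since apex closure is hereditary, it suffices to refute it in the house, the domino and the
    holes themselves. *)
Lemma apex_closed_induced (S T : finType) (h : rel S) (e : rel T) :
  contains_induced h e -> apex_closed e -> apex_closed h.
Proof.
move=> [f f_inj fE] eP z n w n3 zP w0 wn k kle; rewrite -fE.
apply: (eP (f \o z) n); rewrite //= ?fE // => i j ile jle.
by have [zE z_inj] := zP i j ile jle; split; [rewrite /= fE | move/f_inj].
Qed.

Lemma house_not_apex_closed : ~ apex_closed house.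
Proof.
(* Without the endpoint 4 of the complemented path there remains the complement of a 4-vertex path,
   which is the induced path 2, 0, 3, 1. The apex 4 sees its ends but not 3. *)
pose z := nth (@Ordinal 5 2 isT)
  [:: @Ordinal 5 2 isT; @Ordinal 5 0 isT; @Ordinal 5 3 isT; @Ordinal 5 1 isT].
move=> /(_ z 3 (@Ordinal 5 4 isT) isT) houseP.
suff zP : chordless house z 3 by have := houseP zP isT isT 2 isT.
by move=> [|[|[|[|//]]]] [|[|[|[|//]]]] _ _; split=> // /(congr1 val).
Qed.

Lemma domino_not_apex_closed : ~ apex_closed domino.
Proof.
(* The path is the outer cycle without 1. The apex 1 sees the ends 0 and 2, and 4 through the chord,
   but not 5. *)
pose z := nth (@Ordinal 6 0 isT) [:: @Ordinal 6 0 isT; @Ordinal 6 5 isT;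
  @Ordinal 6 4 isT; @Ordinal 6 3 isT; @Ordinal 6 2 isT].
move=> /(_ z 4 (@Ordinal 6 1 isT) isT) dominoP.
suff zP : chordless domino z 4 by have := dominoP zP isT isT 1 isT.
by move=> [|[|[|[|[|//]]]]] [|[|[|[|[|//]]]]] _ _; split=> // /(congr1 val).
Qed.

Lemma hole_not_apex_closed n : 5 <= n -> ~ apex_closed (@cycle_graph n).
Proof.
case: n => // n n4 cycleP.
(* The path is the cycle without 0, and the apex 0 sees only its two ends. *)
pose z k : 'I_n.+1 := inord k.+1.
have n3 : 3 <= n.-1 by lia.
have zE k : k <= n.-1 -> z k = k.+1 :> nat by move=> kn; rewrite inordK; lia.
suff zP : chordless (@cycle_graph n.+1) z n.-1.
  have c0 k : k <= n.-1 -> cycle_graph ord0 (z k) = (k == 0) || (k == n.-1).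
    by move=> kn; rewrite cycle_graphE zE //=; lia.
  have := cycleP z n.-1 ord0 n3 zP; rewrite !c0 // !eqxx ?orbT.
  by move=> /(_ isT isT 1); rewrite c0; lia.
move=> i j ile jle; split; first by rewrite cycle_graphE !zE; lia.
by move/(congr1 val); rewrite /= !zE; lia.
Qed.

Lemma apex_closed_HHD_free (T : finType) (e : rel T) : apex_closed e -> HHD_free e.
Proof.
move=> eP; split=> [h|n n5 h|h]; have := apex_closed_induced h eP.
- exact: house_not_apex_closed.
- exact: hole_not_apex_closed.
- exact: domino_not_apex_closed.
Qed.

(** * Equality of the classes *)

Lemma dominating_class_HHD_free (T : finType) (e : rel T)
    (A : T -> T -> seq T -> Prop) :
    symmetric e -> irreflexive e ->
    (forall u v W, A u v W -> induced_path e u v W) ->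
    (forall u w v, u != v -> ~~ e u v -> e u w -> e w v -> A u v [:: u; w; v]) ->
  dominating_class e A (m3 e) <-> HHD_free e.
Proof.
move=> e_sym e_irr A_induced A_short; split.
  by move/(dominating_apex_closed e_sym A_short)/apex_closed_HHD_free.
by move=> hhd u v uv nuv W W' /A_induced; apply: HHD_free_dominates.
Qed.

Theorem theorem5 (T : finType) (e : rel T)
    (e_sym : symmetric e) (e_irr : irreflexive e)
    (e_conn : connected_graph e) :
  [/\ dominating_class e (l_ e 2) (m3 e) <-> dominating_class e (l_ e 3) (m3 e),
      dominating_class e (l_ e 3) (m3 e) <-> dominating_class e (SP e) (m3 e)
    & dominating_class e (SP e) (m3 e) <-> HHD_free e].
Proof.
have short_l k u w v : 2 <= k -> u != v -> ~~ e u v -> e u w -> e w v ->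
    l_ e k u v [:: u; w; v].
  by move=> k2 uv nuv uw wv; split; first exact: short_path_induced.
have l2P : dominating_class e (l_ e 2) (m3 e) <-> HHD_free e.
  apply: dominating_class_HHD_free => // [u v W []//|u w v]; exact: short_l.
have l3P : dominating_class e (l_ e 3) (m3 e) <-> HHD_free e.
  apply: dominating_class_HHD_free => // [u v W []//|u w v]; exact: short_l.
have SPP : dominating_class e (SP e) (m3 e) <-> HHD_free e.
  apply: dominating_class_HHD_free => //; first exact: SP_induced.
  exact: short_path_SP.
by split; rewrite ?l2P ?l3P ?SPP.
Qed.
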